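(* For every $a>0$ there exists a constant $C$, depending only on $a$, such that for every positive integer $n$ and every real symmetric $n\times n$ matrix $X$ such that $I+X$ is nonsingular and $|X_{ij}|\le a/n$ for all $i,j$, $$\mu_2(I+X)\ \le\ \mu_\infty(I+X)\ \le\ C\,\mu_2(I+X),$$ where $I$ is the $n\times n$ identity matrix.
   Context: For $p\in[1,\infty]$, $\|\vec x\|_p$ denotes the usual $p$-norm on $\mathbb R^n$ (with $\|\vec x\|_\infty=\max_j|x_j|$), and $\|A\|_p=\sup_{\vec x\ne0}\|A\vec x\|_p/\|\vec x\|_p$ is the induced matrix norm. For an invertible matrix $A$, the condition number is $\mu_p(A)=\|A\|_p\cdot\|A^{-1}\|_p$. *)

(* Defs.v *)
From HB Require Import structures.
From mathcomp Require Import all_boot all_order all_algebra.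
From mathcomp Require Import all_classical all_reals all_analysis.

Set Implicit Arguments.
Unset Strict Implicit.
Unset Printing Implicit Defensive.

Import Order.TTheory GRing.Theory Num.Theory.

Local Open Scope classical_set_scope.
Local Open Scope ring_scope.

(* The exponent lives in the extended reals so that p = +oo is allowed; this is
   the usual p-norm for 1 <= p. The value at p = -oo is junk. *)
Definition pnorm (R : realType) (p : \bar R) (n : nat) (x : 'cV[R]_n) : R :=
  match p with
  | r%:E%E => (\sum_(j < n) `|x j ord0| `^ r) `^ r^-1
  | +oo%E => \big[Num.max/0]_(j < n) `|x j ord0|
  | -oo%E => 0
  end.

(* The set is nonempty only if 0 < n, and bounded above when 1 <= p; [sup] is
   then the least upper bound. *)
Definition opnorm (R : realType) (p : \bar R) (n : nat) (A : 'M[R]_n) : R :=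
  sup [set pnorm p (A *m x) / pnorm p x | x in [set x : 'cV[R]_n | x != 0]].

(* [invmx A] is the inverse of A only when A \in unitmx. *)
Definition condnum (R : realType) (p : \bar R) (n : nat) (A : 'M[R]_n) : R :=
  opnorm p A * opnorm p (invmx A).

(* Main.v *)
Require Import Defs.
From HB Require Import structures.
From mathcomp Require Import all_boot all_order all_algebra.
From mathcomp Require Import all_classical all_reals all_analysis.
From mathcomp Require Import ring lra.

Set Implicit Arguments.
Unset Strict Implicit.
Unset Printing Implicit Defensive.

Import Order.TTheory GRing.Theory Num.Theory.

Local Open Scope ring_scope.

(** Write A = 1 + X and B for its inverse; both are symmetric.

    For symmetric M, ||M||_2 <= ||M||_oo ([sym_opnorm2_le_opnormoo], by Schur's
    test), and applying this to A and to B gives the left inequality.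

    For the right inequality there are two regimes.  If n <= 2 a, the general
    comparison ||M||_oo <= sqrt n ||M||_2
    ([sym_opnormoo_le_opnorm2]), used for A and for B, costs a factor n, which is
    at most 2 a.  If n > 2 a, the diagonal entries of A are at least 1 / 2, so
    ||A||_2 >= 1 / 2, while the row sums of A give ||A||_oo <= 1 + a.  The heart
    of the matter is the bound ||B||_oo <= 1 + a + a^2 ||B||_2
    ([opnormoo_invmx_small_entries]), which is uniform in n: X B X is
    entrywise small because the columns of X are short in the 2-norm.  Then
    mu_oo <= (1 + a)^2 + (1 + a) a^2 ||B||_2.  The first term is at most
    (1 + a)^2 mu_2, since mu_2 >= 1 ([sym_condnum2_ge1]); the second is at most
    2 (1 + a) a^2 mu_2, since ||B||_2 <= 2 ||A||_2 ||B||_2. *)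

(** * Finite sums *)

Lemma sum_kronecker (R : nzRingType) (I : finType) (i : I) :
  \sum_j (i == j)%:R = 1 :> R.
Proof.
by rewrite (bigD1 i) //= eqxx big1 ?addr0 // => j; rewrite eq_sym => /negbTE ->.
Qed.

(** Lagrange's identity: the right-hand side minus the left-hand side is half the
    sum over i and j of w_i w_j (x_i y_j - x_j y_i)^2. *)
Lemma weighted_Cauchy_Schwarz (R : realType) (I : finType) (w x y : I -> R) :
  (forall i, 0 <= w i) ->
  (\sum_i w i * x i * y i) ^+ 2
    <= (\sum_i w i * x i ^+ 2) * (\sum_i w i * y i ^+ 2).
Proof.
move=> w0.
have : 0 <= \sum_i \sum_j w i * w j * (x i * y j - x j * y i) ^+ 2.
  apply: sumr_ge0 => i _; apply: sumr_ge0 => j _.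
  by apply: mulr_ge0; rewrite ?sqr_ge0 ?mulr_ge0.
have -> : \sum_i \sum_j w i * w j * (x i * y j - x j * y i) ^+ 2 =
    (\sum_i w i * x i ^+ 2) * (\sum_i w i * y i ^+ 2)
    + (\sum_i w i * y i ^+ 2) * (\sum_i w i * x i ^+ 2)
    - 2 * ((\sum_i w i * x i * y i) * (\sum_i w i * x i * y i)).
  rewrite !big_distrlr /= mulr_sumr -big_split -sumrB /=; apply: eq_bigr => i _.
  rewrite mulr_sumr -big_split -sumrB /=.
  by apply: eq_bigr => j _; ring.
rewrite -expr2; lra.
Qed.

(** * The 2-norm and the max-norm of a vector *)

Section Norms.
Context {R : realType}.

Lemma pnorm_ge0 (p : \bar R) n (x : 'cV[R]_n) : 0 <= pnorm p x.
Proof.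
case: p => [r||] //=; first exact: powR_ge0.
exact: bigmax_ge_id.
Qed.

Lemma pnorm0 (p : \bar R) n : (1 <= p)%E -> pnorm p (0 : 'cV[R]_n) = 0.
Proof.
case: p => [r||] //=.
- rewrite lee_fin => r1.
  have r0 : r != 0 by rewrite gt_eqF // (lt_le_trans ltr01).
  by rewrite big1 ?powR0 ?invr_neq0 // => i _; rewrite mxE normr0 powR0.
- move=> _; apply/eqP; rewrite eq_le bigmax_ge_id andbT.
  by apply: bigmax_le => // i _; rewrite mxE normr0.
Qed.

Lemma pnorm2_sqr n (x : 'cV[R]_n) : pnorm 2%:E x ^+ 2 = \sum_j x j ord0 ^+ 2.
Proof.
rewrite /pnorm powR12_sqrt; last by apply: sumr_ge0 => i _; exact: powR_ge0.
rewrite sqr_sqrtr; last by apply: sumr_ge0 => i _; exact: powR_ge0.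
by apply: eq_bigr => i _; rewrite powR_mulrn // real_normK ?num_real.
Qed.

Lemma ler_pnorm2 m n (x : 'cV[R]_m) (y : 'cV[R]_n) (M : R) : 0 <= M ->
  \sum_j x j ord0 ^+ 2 <= M ^+ 2 * \sum_j y j ord0 ^+ 2 ->
  pnorm 2%:E x <= M * pnorm 2%:E y.
Proof.
move=> M0; rewrite -!pnorm2_sqr -exprMn ler_pXn2r //;
  by rewrite nnegrE ?mulr_ge0 ?pnorm_ge0.
Qed.

Lemma le_pnormoo n (x : 'cV[R]_n) i : `|x i ord0| <= pnorm +oo%E x.
Proof. exact: le_bigmax. Qed.

Lemma pnormoo_le n (x : 'cV[R]_n) M : 0 <= M ->
  (forall i, `|x i ord0| <= M) -> pnorm +oo%E x <= M.
Proof. by move=> M0 xM; apply: bigmax_le. Qed.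

Lemma norm_dot_le n (x y : 'cV[R]_n) :
  `|\sum_i x i ord0 * y i ord0| <= pnorm 2%:E x * pnorm 2%:E y.
Proof.
rewrite -(@ler_pXn2r _ 2) ?nnegrE ?mulr_ge0 ?pnorm_ge0 //.
rewrite real_normK ?num_real // exprMn.
rewrite [X in _ <= X * _]pnorm2_sqr [X in _ <= _ * X]pnorm2_sqr.
have := weighted_Cauchy_Schwarz (x ^~ ord0) (y ^~ ord0)
  (fun=> ler01 : 0 <= (1 : R)).
by congr (is_true (_ ^+ 2 <= _ * _)); apply: eq_bigr => i _; rewrite mul1r.
Qed.

Lemma pnormoo_le_pnorm2 n (x : 'cV[R]_n) : pnorm +oo%E x <= pnorm 2%:E x.
Proof.
apply: pnormoo_le (pnorm_ge0 _ _) _ => i.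
rewrite -(@ler_pXn2r _ 2) ?nnegrE ?pnorm_ge0 // real_normK ?num_real //.
rewrite pnorm2_sqr (bigD1 i) //= lerDl.
by apply: sumr_ge0 => j _; exact: sqr_ge0.
Qed.

Lemma pnorm2_le_pnormoo n (x : 'cV[R]_n) :
  pnorm 2%:E x <= Num.sqrt n%:R * pnorm +oo%E x.
Proof.
rewrite -(@ler_pXn2r _ 2) ?nnegrE ?mulr_ge0 ?sqrtr_ge0 ?pnorm_ge0 //.
rewrite exprMn sqr_sqrtr ?ler0n // pnorm2_sqr mulr_natl.
rewrite -[X in _ *+ X]card_ord -sumr_const; apply: ler_sum => i _.
by rewrite -real_normK ?num_real // ler_pXn2r ?nnegrE ?pnorm_ge0 ?le_pnormoo.
Qed.

(** * Induced norms *)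

Section OpNorm.
Variable n : nat.
Implicit Types (p : \bar R) (A B X : 'M[R]_n).

Lemma pnorm_ratio_ubound p A M : 0 <= M ->
  (forall x, pnorm p (A *m x) <= M * pnorm p x) ->
  ubound [set pnorm p (A *m x) / pnorm p x
            | x in [set x : 'cV[R]_n | x != 0]]%classic M.
Proof.
move=> M0 AM _ [x /= _ <-].
have [->|x0] := eqVneq (pnorm p x) 0; first by rewrite invr0 mulr0.
by rewrite ler_pdivrMr // lt0r x0 pnorm_ge0.
Qed.

Lemma opnorm_le p A M : (0 < n)%N -> 0 <= M ->
  (forall x, pnorm p (A *m x) <= M * pnorm p x) -> opnorm p A <= M.
Proof.
move=> n0 M0 AM; apply: ge_sup; last exact: pnorm_ratio_ubound.
exists (pnorm p (A *m const_mx 1) / pnorm p (const_mx 1 : 'cV[R]_n)).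
exists (const_mx 1) => //=; apply/eqP => /matrixP/(_ (Ordinal n0) ord0).
by rewrite !mxE; apply/eqP; rewrite oner_eq0.
Qed.

(** [opnorm] is a supremum in the reals, meaningful only once the quotients are
    known to be bounded.  Hence the operator inequality
    [pnorm p (A *m x) <= opnorm p A * pnorm p x] is derived from some a priori
    bound M of the same shape: the maximal row sum when p is infinite, and then
    [opnorm +oo A] when p = 2 and A is symmetric. *)
Lemma pnorm_mulmx_le p A M (x : 'cV[R]_n) : (1 <= p)%E -> 0 <= M ->
  (forall y, pnorm p (A *m y) <= M * pnorm p y) ->
  pnorm p (A *m x) <= opnorm p A * pnorm p x.
Proof.
move=> p1 M0 AM.
have [x0|x0] := eqVneq (pnorm p x) 0.
  by have := AM x; rewrite x0 !mulr0.
rewrite -ler_pdivrMr ?lt0r ?x0 ?pnorm_ge0 //; apply: ub_le_sup.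
  by exists M; exact: pnorm_ratio_ubound.
exists x => //=; apply/eqP => x_eq0.
by move: x0; rewrite x_eq0 pnorm0 // eqxx.
Qed.

Lemma pnormoo_mulmx_le_row_sums A M (x : 'cV[R]_n) : 0 <= M ->
  (forall i, \sum_j `|A i j| <= M) ->
  pnorm +oo%E (A *m x) <= M * pnorm +oo%E x.
Proof.
move=> M0 AM; apply: pnormoo_le => [|i]; first by rewrite mulr_ge0 ?pnorm_ge0.
rewrite mxE (le_trans (ler_norm_sum _ _ _)) //.
apply: (@le_trans _ _ (\sum_j `|A i j| * pnorm +oo%E x)).
  by apply: ler_sum => j _; rewrite normrM ler_wpM2l // le_pnormoo.
by rewrite -mulr_suml ler_wpM2r // pnorm_ge0.
Qed.

Lemma opnormoo_le_row_sums A M : (0 < n)%N -> 0 <= M ->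
  (forall i, \sum_j `|A i j| <= M) -> opnorm +oo%E A <= M.
Proof.
move=> n0 M0 AM; apply: opnorm_le => // x.
exact: pnormoo_mulmx_le_row_sums.
Qed.

Lemma pnormoo_mulmx_le A (x : 'cV[R]_n) :
  pnorm +oo%E (A *m x) <= opnorm +oo%E A * pnorm +oo%E x.
Proof.
apply: (@pnorm_mulmx_le _ _ (\big[Num.max/0]_i \sum_j `|A i j|)) => [||y].
- by rewrite leey.
- exact: bigmax_ge_id.
- apply: pnormoo_mulmx_le_row_sums => [|i]; first exact: bigmax_ge_id.
  exact: le_bigmax.
Qed.

(** Row i is tested against its own sign vector, whose max-norm is 1; the i-th
    entry of the image is then the absolute sum of that row. *)
Lemma row_sum_le_opnormoo A i : \sum_j `|A i j| <= opnorm +oo%E A.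
Proof.
(* The sign at a zero entry is taken to be 1, so that s has max-norm 1 even when
   row i vanishes. *)
pose s : 'cV[R]_n := \col_j (if 0 <= A i j then 1 else -1).
have s1 j : `|s j ord0| = 1 by rewrite mxE; case: ifP; rewrite ?normrN normr1.
have -> : \sum_j `|A i j| = (A *m s) i ord0.
  rewrite mxE; apply: eq_bigr => j _; rewrite mxE.
  by case: (ger0P (A i j)) => ?; rewrite ?mulr1 ?mulrN1.
apply: le_trans (ler_norm _) _; apply: le_trans (le_pnormoo _ _) _.
apply: le_trans (pnormoo_mulmx_le _ _) _.
have -> : pnorm +oo%E s = 1; last by rewrite mulr1.
apply/eqP; rewrite eq_le pnormoo_le //=; last by move=> j; rewrite s1.
by rewrite -(s1 i) le_pnormoo.
Qed.

Lemma opnormoo_ge0 A : (0 < n)%N -> 0 <= opnorm +oo%E A.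
Proof.
move=> n0; apply: le_trans (row_sum_le_opnormoo A (Ordinal n0)).
by apply: sumr_ge0.
Qed.

(** Schur's test.  Cauchy-Schwarz with the weights |A_ij| bounds the square of
    (A x)_i by the product of the i-th row sum and the sum of |A_ij| x_j^2.
    Summing over i leaves, in front of each x_j^2, the j-th column sum, which is
    again a row sum because A is symmetric. *)
Lemma sym_pnorm2_mulmx_le_opnormoo A (x : 'cV[R]_n) : (0 < n)%N -> A^T = A ->
  pnorm 2%:E (A *m x) <= opnorm +oo%E A * pnorm 2%:E x.
Proof.
move=> n0 sA; set M := opnorm _ A; have M0 : 0 <= M by exact: opnormoo_ge0.
have Aji i j : A j i = A i j by rewrite -[in LHS]sA mxE.
apply: ler_pnorm2 => //.
apply: (@le_trans _ _ (\sum_i M * \sum_j `|A i j| * x j ord0 ^+ 2)).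
  apply: ler_sum => i _; rewrite mxE.
  apply: (@le_trans _ _ ((\sum_j `|A i j| * 1 * `|x j ord0|) ^+ 2)).
    rewrite -real_normK ?num_real // ler_pXn2r ?nnegrE //; last first.
      by apply: sumr_ge0 => j _; rewrite mulr1 mulr_ge0.
    apply: le_trans (ler_norm_sum _ _ _) _.
    by apply: ler_sum => j _; rewrite mulr1 normrM.
  apply: le_trans (weighted_Cauchy_Schwarz _ _ _) _ => //.
  under [X in _ * X <= _]eq_bigr do rewrite real_normK ?num_real //.
  apply: ler_wpM2r.
    by apply: sumr_ge0 => j _; rewrite mulr_ge0 ?sqr_ge0.
  under eq_bigr do rewrite expr1n mulr1.
  exact: row_sum_le_opnormoo.
rewrite -mulr_sumr expr2 -mulrA ler_wpM2l // exchange_big /= mulr_sumr.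
apply: ler_sum => j _; rewrite -mulr_suml ler_wpM2r ?sqr_ge0 //.
by under eq_bigr do rewrite Aji; exact: row_sum_le_opnormoo.
Qed.

Lemma sym_pnorm2_mulmx_le A (x : 'cV[R]_n) : (0 < n)%N -> A^T = A ->
  pnorm 2%:E (A *m x) <= opnorm 2%:E A * pnorm 2%:E x.
Proof.
move=> n0 sA; apply: (@pnorm_mulmx_le _ _ (opnorm +oo%E A)) => [||y].
- by rewrite lee_fin ler1n.
- exact: opnormoo_ge0.
- exact: sym_pnorm2_mulmx_le_opnormoo.
Qed.

Lemma sym_opnorm2_le_opnormoo A : (0 < n)%N -> A^T = A ->
  opnorm 2%:E A <= opnorm +oo%E A.
Proof.
move=> n0 sA; apply: opnorm_le => // [|x]; first exact: opnormoo_ge0.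
exact: sym_pnorm2_mulmx_le_opnormoo.
Qed.

Lemma pnorm2_delta (i : 'I_n) : pnorm 2%:E (delta_mx i ord0 : 'cV[R]_n) = 1.
Proof.
apply/eqP; rewrite -(@eqrXn2 _ 2) ?pnorm_ge0 // expr1n pnorm2_sqr (bigD1 i) //=.
rewrite big1 ?addr0; first by rewrite mxE !eqxx expr1n.
by move=> j /negbTE ji; rewrite mxE ji expr0n.
Qed.

Lemma sym_entry_le_opnorm2 A i j : A^T = A -> `|A i j| <= opnorm 2%:E A.
Proof.
move=> sA; have n0 : (0 < n)%N by apply: leq_ltn_trans (ltn_ord i).
have := sym_pnorm2_mulmx_le (delta_mx j ord0) n0 sA.
rewrite pnorm2_delta mulr1; apply: le_trans.
apply: le_trans (pnormoo_le_pnorm2 _); apply: le_trans (le_pnormoo _ i).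
by rewrite -colE mxE.
Qed.

Lemma sym_opnorm2_ge0 A : (0 < n)%N -> A^T = A -> 0 <= opnorm 2%:E A.
Proof.
by move=> n0 /(sym_entry_le_opnorm2 (Ordinal n0) (Ordinal n0)); apply: le_trans.
Qed.

(** The factor sqrt n is paid once, in passing from the 2-norm of x back to its
    max-norm. *)
Lemma sym_opnormoo_le_opnorm2 A : (0 < n)%N -> A^T = A ->
  opnorm +oo%E A <= Num.sqrt n%:R * opnorm 2%:E A.
Proof.
move=> n0 sA; have A0 := sym_opnorm2_ge0 n0 sA.
apply: opnorm_le => // [|x]; first by rewrite mulr_ge0 ?sqrtr_ge0.
apply: le_trans (pnormoo_le_pnorm2 _) _.
apply: le_trans (sym_pnorm2_mulmx_le _ _ _) _ => //.
by rewrite mulrAC [leRHS]mulrC ler_wpM2l // pnorm2_le_pnormoo.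
Qed.

Lemma invmx_sym A : A^T = A -> (invmx A)^T = invmx A.
Proof. by move=> sA; rewrite trmx_inv sA. Qed.

(** A unit vector e equals the inverse of A applied to A e. *)
Lemma sym_condnum2_ge1 A : (0 < n)%N -> A^T = A -> A \in unitmx ->
  1 <= condnum 2%:E A.
Proof.
move=> n0 sA uA; rewrite /condnum mulrC.
pose e : 'cV[R]_n := delta_mx (Ordinal n0) ord0.
have : pnorm 2%:E e = 1 by exact: pnorm2_delta.
rewrite -(mulKmx uA e) => {1}<-.
have sB := invmx_sym sA.
apply: le_trans (sym_pnorm2_mulmx_le _ n0 sB) _.
rewrite -[leRHS]mulr1 -[X in _ <= _ * X](pnorm2_delta (Ordinal n0)) -mulrA.
apply: ler_wpM2l; first exact: sym_opnorm2_ge0.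
exact: sym_pnorm2_mulmx_le.
Qed.

(** * The inverse of a perturbation of the identity *)

(** Write B for the inverse of 1 + X.  Then B = 1 - X + X B X, and the point of
    having X on both sides of B is that the (i, j) entry of X B X is the inner
    product of two columns: column i of X, and the image under B of column j.
    Columns of X have 2-norm at most a / sqrt n, so every entry of X B X is at
    most ||B||_2 a^2 / n, and a row of n such entries contributes only
    a^2 ||B||_2, with no dependence on n. *)
Lemma opnormoo_invmx_small_entries X (a : R) : (0 < n)%N -> 0 <= a ->
  X^T = X -> 1%:M + X \in unitmx ->
  (forall i j, `|X i j| <= a / n%:R) ->
  opnorm +oo%E (invmx (1%:M + X))
    <= 1 + a + a ^+ 2 * opnorm 2%:E (invmx (1%:M + X)).
Proof.
move=> n0 a0 sX uA Xa; set B := invmx _.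
have sA : (1%:M + X)^T = 1%:M + X by rewrite linearD /= trmx1 sX.
have sB : B^T = B by exact: invmx_sym.
have b0 := sym_opnorm2_ge0 n0 sB.
have nR : (0 : R) < n%:R by rewrite ltr0n.
have BE : B = 1%:M - X + X *m (B *m X).
  have e1 : B + X *m B = 1%:M by rewrite -{1}[B]mul1mx -mulmxDl mulmxV.
  have e2 : B + B *m X = 1%:M by rewrite -{1}[B]mulmx1 -mulmxDr mulVmx.
  have -> : B *m X = 1%:M - B by rewrite -e2 addrAC subrr add0r.
  by rewrite mulmxBr mulmx1 addrA subrK -e1 addrK.
have colX j : pnorm 2%:E (col j X) ^+ 2 <= a ^+ 2 / n%:R.
  rewrite pnorm2_sqr.
  apply: (@le_trans _ _ (\sum_(k < n) (a / n%:R) ^+ 2)).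
    apply: ler_sum => k _; rewrite mxE -real_normK ?num_real //.
    by rewrite ler_pXn2r ?nnegrE // ?divr_ge0 // ltW.
  rewrite sumr_const card_ord -mulr_natl le_eqVlt; apply/orP; left.
  by apply/eqP; field; rewrite gt_eqF.
have XBX i j : `|(X *m (B *m X)) i j| <= a ^+ 2 / n%:R * opnorm 2%:E B.
  have -> : (X *m (B *m X)) i j
      = \sum_k (col i X) k ord0 * (B *m col j X) k ord0.
    have -> : B *m col j X = col j (B *m X) by rewrite !colE mulmxA.
    rewrite mxE; apply: eq_bigr => k _.
    have -> : X i k = X k i by rewrite -[in LHS]sX mxE.
    by rewrite [col i X k _]mxE [col j _ k _]mxE.
  apply: le_trans (norm_dot_le _ _) _.
  have := sym_pnorm2_mulmx_le (col j X) n0 sB.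
  have := colX i; have := colX j.
  have := pnorm_ge0 2%:E (col i X); have := pnorm_ge0 2%:E (col j X).
  set u := pnorm _ (col i X); set v := pnorm _ (col j X).
  set c := a ^+ 2 / n%:R => v0 u0 vc uc h.
  apply: le_trans (ler_wpM2l u0 h) _.
  (* By the arithmetic-geometric mean inequality, which avoids square roots. *)
  have uv : u * v <= c by nra.
  by rewrite mulrCA mulrC ler_wpM2r.
apply: opnormoo_le_row_sums => // [|i].
  by rewrite !addr_ge0 ?mulr_ge0 ?sqr_ge0.
apply: (@le_trans _ _ (\sum_j ((i == j)%:R + a / n%:R
    + a ^+ 2 / n%:R * opnorm 2%:E B))).
  apply: ler_sum => j _; rewrite {1}BE mxE mxE mxE [(- X) i j]mxE.
  apply: le_trans (ler_normD _ _) _; apply: lerD (XBX i j).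
  apply: le_trans (ler_normB _ _) _; apply: lerD (Xa i j).
  by rewrite normr_nat.
rewrite !big_split /= !sumr_const card_ord -[X in _ + X + _]mulr_natl.
rewrite -[X in _ + X]mulr_natl.
rewrite sum_kronecker.
by rewrite le_eqVlt; apply/orP; left; apply/eqP; field; rewrite gt_eqF.
Qed.

End OpNorm.
End Norms.

(** * Comparison of the condition numbers *)

Theorem lemma3p2 (R : realType) (a : R) (ha : 0 < a) :
  exists C : R, forall (n : nat) (X : 'M[R]_n),
    (0 < n)%N ->
    X^T = X ->
    1%:M + X \in unitmx ->
    (forall i j : 'I_n, `|X i j| <= a / n%:R) ->
    condnum 2%:E (1%:M + X) <= condnum +oo%E (1%:M + X)
      <= C * condnum 2%:E (1%:M + X).
Proof.
(* The first summand serves the dimensions n <= 2 a; the other two serve the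
   larger ones, where the 2-norm of 1 + X is at least 1 / 2. *)
set C := 2 * a + (1 + a) ^+ 2 + 2 * (1 + a) * a ^+ 2.
have C_large al be : 1 <= al * be -> 0 <= be -> 1 / 2 <= al ->
    (1 + a) * (1 + a + a ^+ 2 * be) <= C * (al * be).
  move=> mu1 be0 al2.
  have a1 : 0 <= (1 + a) * a ^+ 2.
    by apply: mulr_ge0; [lra | exact: sqr_ge0].
  have t1 : (1 + a) ^+ 2 <= (1 + a) ^+ 2 * (al * be).
    by apply: ler_peMr mu1; exact: sqr_ge0.
  have be_mu : be <= 2 * (al * be) by nra.
  have t2 := ler_wpM2l a1 be_mu.
  have t3 : 0 <= 2 * a * (al * be) by apply: mulr_ge0; lra.
  rewrite /C; lra.
have C_small : 2 * a <= C.
  have : 0 <= 2 * (1 + a) * a ^+ 2.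
    by apply: mulr_ge0; [lra | exact: sqr_ge0].
  have := sqr_ge0 (1 + a); rewrite /C; lra.
exists C => n X n0 sX uA Xa.
have nR : (0 : R) < n%:R by rewrite ltr0n.
have sA : (1%:M + X)^T = 1%:M + X by rewrite linearD /= trmx1 sX.
have sB := invmx_sym sA.
have mu1 := sym_condnum2_ge1 n0 sA uA.
have A0 := sym_opnorm2_ge0 n0 sA; have B0 := sym_opnorm2_ge0 n0 sB.
have A0' := opnormoo_ge0 (1%:M + X) n0.
have B0' := opnormoo_ge0 (invmx (1%:M + X)) n0.
apply/andP; split.
  exact: ler_pM A0 B0 (sym_opnorm2_le_opnormoo n0 sA)
    (sym_opnorm2_le_opnormoo n0 sB).
(* Below 2 a the diagonal of 1 + X may nearly vanish, but n itself is bounded. *)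
have [n_small|n_large] := leP n%:R (2 * a).
  have muoo : condnum +oo%E (1%:M + X) <= n%:R * condnum 2%:E (1%:M + X).
    rewrite -[n%:R](@sqr_sqrtr R) ?ler0n // /condnum expr2 mulrACA.
    exact: ler_pM A0' B0' (sym_opnormoo_le_opnorm2 n0 sA)
      (sym_opnormoo_le_opnorm2 n0 sB).
  apply: le_trans muoo _; apply: ler_wpM2r; first exact: le_trans ler01 mu1.
  exact: le_trans n_small C_small.
have normA : opnorm +oo%E (1%:M + X) <= 1 + a.
  apply: opnormoo_le_row_sums => // [|i].
    by rewrite addr_ge0 ?ler01 ?ltW.
  apply: (@le_trans _ _ (\sum_j ((i == j)%:R + a / n%:R))).
    apply: ler_sum => j _; rewrite mxE mxE.
    by apply: le_trans (ler_normD _ _) _; rewrite normr_nat lerD2l.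
  rewrite big_split /= sumr_const card_ord sum_kronecker.
  by rewrite -[(a / _) *+ _]mulr_natr divfK // gt_eqF.
have normA2 : 1 / 2 <= opnorm 2%:E (1%:M + X).
  pose i := Ordinal n0.
  apply: le_trans (sym_entry_le_opnorm2 i i sA).
  have : `|X i i| <= 1 / 2.
    apply: le_trans (Xa i i) _; rewrite ler_pdivrMr //.
    by clear -n_large; lra.
  rewrite mxE mxE eqxx mulr1n ler_norml => /andP[Xii _].
  by apply: le_trans (ler_norm _); clear -Xii; lra.
have normB := opnormoo_invmx_small_entries n0 (ltW ha) sX uA Xa.
apply: le_trans (ler_pM A0' B0' normA normB) _.
exact: C_large mu1 B0 normA2.
Qed.
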